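(* Let $G$ be an undirected graph with vertex set $\{1,\ldots,n\}$, let $A$ be its adjacency matrix, let $\mu_1\ge\mu_2\ge\cdots\ge\mu_n$ be the eigenvalues of $A$ sorted in non-increasing order (counted with multiplicity), and let $\chi$ be the chromatic number of $G$. Then $$\chi \;\ge\; 1+\max_{m=1,\ldots,n-1}\left\{\frac{\sum_{i=1}^m \mu_i}{-\sum_{i=1}^m \mu_{n-i+1}}\right\}.$$
   Context: The adjacency matrix of $G$ is the $n\times n$ matrix $A=(a_{k\ell})$ with $a_{k\ell}=1$ if $(k,\ell)$ is an edge and $a_{k\ell}=0$ otherwise. The chromatic number $\chi$ is the least $c$ for which there is a map $\Phi:\{1,\ldots,n\}\to\{1,\ldots,c\}$ with $\Phi(k)\ne\Phi(\ell)$ whenever $a_{k\ell}=1$. *)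

(* Defs.v *)
From HB Require Import structures.
From mathcomp Require Import all_boot all_order all_algebra.

Set Implicit Arguments.
Unset Strict Implicit.
Unset Printing Implicit Defensive.

Import Order.TTheory GRing.Theory Num.Theory.

Local Open Scope ring_scope.

Record sgraph (n : nat) := SGraph {
  adj :> rel 'I_n;
  adj_sym : symmetric adj;
  adj_irr : irreflexive adj
}.

Definition adjmx (R : nzRingType) (n : nat) (G : sgraph n) : 'M[R]_n :=
  \matrix_(k, l) (G k l)%:R.

Definition colorable (n : nat) (G : sgraph n) (c : nat) : bool :=
  [exists Phi : {ffun 'I_n -> 'I_c},
    [forall k, forall l, G k l ==> (Phi k != Phi l)]].

Lemma colorable_ex (n : nat) (G : sgraph n) : exists c, colorable G c.
Proof.
exists n; apply/existsP; exists [ffun k => k].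
apply/forallP=> k; apply/forallP=> l; apply/implyP=> Gkl.
by rewrite !ffunE; apply: contraTneq Gkl => ->; rewrite adj_irr.
Qed.

Definition chromatic_number (n : nat) (G : sgraph n) : nat :=
  ex_minn (colorable_ex G).

(* The roots of the characteristic polynomial, listed with multiplicity; for a
   symmetric real matrix these multiplicities are also the geometric ones. *)
Definition sorted_eigenvalues (R : rcfType) (n : nat) (A : 'M[R]_n)
    (mu : n.-tuple R) : Prop :=
  sorted >=%R mu /\ char_poly A = \prod_(x <- mu) ('X - x%:P).

(* Indices are shifted by one: mu`_i is the (i+1)-st largest eigenvalue. Both
   sums vanish when the graph has no edge, and the value is then 0 / 0 = 0. *)
Definition eigen_ratio (R : rcfType) (n : nat) (mu : n.-tuple R) (m : nat) : R :=
  (\sum_(0 <= i < m) mu`_i) / (- \sum_(0 <= i < m) mu`_(n - i.+1)).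

(* Main.v *)
Require Import Defs.
From HB Require Import structures.
From mathcomp Require Import all_boot all_order all_algebra.
From mathcomp Require Import perm complex ring.

(** Let [c] be the number of colours, [E a] the diagonal projection onto the
    vertices of colour [a], and [w_1, ..., w_n] an orthonormal eigenbasis of the
    adjacency matrix [A], with [w_i] belonging to [mu_i]. No edge joins two
    vertices of the same colour, which is to say that [E a * A * E a = 0] for
    every [a].

    The heart of the proof is that [- mu], divided by [c - 1], is majorized by
    [mu]. This is witnessed by the kernel
<<
      K i j = c * (sum over a of |<E a w_i, w_j>|^2) - (1 if i = j, else 0),
>>
    which is symmetric. It is nonnegative by Cauchy-Schwarz, because the numbers
    [<E a w_i, w_j>] add up over [a] to [<w_i, w_j>]. Its rows add up to [c - 1]
    by Parseval. It sends [mu] to [- mu] because the sum over [j] of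
    [mu_j |<E a w_i, w_j>|^2] is the quadratic form of [A] at [E a w_i], which
    vanishes ([majorization_kernel]).

    Adding up [- mu_i = \sum_j mu_j K i j] over [i <= m] writes the opposite of
    the sum of the [m] largest eigenvalues as a weighted sum of all of them, with
    weights between [0] and [c - 1] and of total [m (c - 1)]. Such a sum is
    smallest when the weight sits on the [m] smallest eigenvalues
    ([weighted_sum_ge_tail]), so the sum of the [m] largest eigenvalues is at
    most [c - 1] times the opposite of the sum of the [m] smallest
    ([majorization_bound]). Dividing gives the theorem.

    The eigenbasis is obtained from the spectral theorem for normal matrices over
    the algebraically closed field [R[i]]; the resulting inequality between real
    numbers is then read back in [R]. *)

Set Implicit Arguments.
Unset Strict Implicit.
Unset Printing Implicit Defensive.

Import Order.TTheory GRing.Theory Num.Theory.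

Local Open Scope ring_scope.
Local Open Scope sesquilinear_scope.

(** * Inequalities for finite sums *)

(** Cauchy-Schwarz against the all-ones vector: the difference of the two sides,
    after passing to the norms, is half the sum of all
    [(`|z a| - `|z b|) ^+ 2]. *)
Lemma sqr_norm_sum_le (C : numDomainType) (c : nat) (z : 'I_c -> C) :
  `|\sum_a z a| ^+ 2 <= c%:R * \sum_a `|z a| ^+ 2.
Proof.
apply: (@le_trans _ _ ((\sum_a `|z a|) ^+ 2)).
  by rewrite lerXn2r ?ler_norm_sum ?nnegrE // sumr_ge0.
have ge0 : 0 <= \sum_a \sum_b (`|z a| - `|z b|) ^+ 2.
  apply: sumr_ge0 => a _; apply: sumr_ge0 => b _.
  by rewrite real_exprn_even_ge0 // rpredB // normr_real.
pose x a := `|z a|; pose S := \sum_a x a; pose T := \sum_a x a ^+ 2.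
have sum_b a : \sum_b (x a - x b) ^+ 2 = c%:R * x a ^+ 2 - x a * S *+ 2 + T.
  under eq_bigr => b _ do rewrite sqrrB.
  by rewrite big_split sumrB /= sumr_const card_ord sumrMnl -mulr_sumr
    mulr_natl.
have eq_dbl : \sum_a \sum_b (x a - x b) ^+ 2 = (c%:R * T - S ^+ 2) *+ 2.
  under eq_bigr => a _ do rewrite sum_b.
  rewrite big_split sumrB /= sumr_const card_ord sumrMnl -mulr_suml -mulr_sumr.
  by rewrite -/S -/T -mulr_natl; ring.
by move: ge0; rewrite eq_dbl pmulrn_lge0 // subr_ge0.
Qed.

Lemma sum_last_ord (V : nmodType) (n m : nat) (f : nat -> V) : (m <= n)%N ->
  \sum_(j < n | (n - m <= j)%N) f j = \sum_(0 <= i < m) f (n - i.+1)%N.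
Proof.
move=> m_le; rewrite -(big_mkord (fun j => (n - m <= j)%N) f).
rewrite -(big_nat_widenl _ 0 n predT) // big_nat_rev.
rewrite -[X in \big[_/_]_(X <= _ < _) _]add0n big_addn subKn //.
by apply: eq_bigr => i _; rewrite [(_ - _ + n)%N]addnC -addSn subnDr.
Qed.

(** The bathtub principle: with weights between [0] and [t] of total [m t], the
    sum is least when the last [m] indices, where [mu] is smallest, carry weight [t]. *)
Lemma weighted_sum_ge_tail (F : numDomainType) (n m : nat)
    (mu q : 'I_n -> F) (t : F)
    (mu_mono : forall i j : 'I_n, (i <= j)%N -> mu j <= mu i)
    (m_gt0 : (0 < m)%N) (m_le : (m <= n)%N)
    (q_ge0 : forall j, 0 <= q j) (q_le : forall j, q j <= t)
    (q_sum : \sum_j q j = m%:R * t) :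
  t * \sum_(j < n | (n - m <= j)%N) mu j <= \sum_j mu j * q j.
Proof.
have k_lt : (n - m < n)%N by rewrite ltn_subrL m_gt0 (leq_trans m_gt0).
(* With e the optimal weights and theta the value of mu at the threshold,
   q - e has total 0, so mu may be replaced by mu - theta in the difference of
   the two sums; then every term is a product of two factors of the same sign. *)
pose theta := mu (Ordinal k_lt).
pose e (j : 'I_n) : F := if (n - m <= j)%N then t else 0.
have e_sum : \sum_j e j = m%:R * t.
  by rewrite -big_mkcond sum_last_ord // sumr_const_nat subn0 mulr_natl.
rewrite -subr_ge0.
have -> : \sum_j mu j * q j - t * \sum_(j < n | (n - m <= j)%N) mu j
    = \sum_j (mu j - theta) * (q j - e j).
  have -> : t * (\sum_(j < n | (n - m <= j)%N) mu j) = \sum_j mu j * e j.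
    rewrite mulr_sumr big_mkcond; apply: eq_bigr => j _.
    by rewrite /e; case: ifP; rewrite ?mulr0 // mulrC.
  have theta0 : \sum_j theta * (q j - e j) = 0.
    by rewrite -mulr_sumr sumrB q_sum e_sum subrr mulr0.
  under [RHS]eq_bigr => j _ do rewrite mulrBl.
  rewrite sumrB theta0 subr0 -sumrB.
  by apply: eq_bigr => j _; rewrite mulrBr.
apply: sumr_ge0 => j _; rewrite /e; case: leqP => [le_j|lt_j].
  by rewrite mulr_le0 // subr_le0 ?q_le //; apply: mu_mono.
by rewrite mulr_ge0 // ?subr0 // subr_ge0; apply: mu_mono; apply: ltnW.
Qed.

(** * The majorization *)

(** Here everything is written in the eigenbasis: [B a] is the matrix of the
    projection [E a], and [A] has become [diag_mx mu]. Since [B a] is a Hermitian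
    projection, [\sum_j `|B a i j| ^+ 2 = B a i i], which gives the row sums;
    and [\sum_j mu j * `|B a i j| ^+ 2] is the [i]-th diagonal entry of
    [B a *m diag_mx mu *m B a]. *)
Lemma majorization_kernel (C : numClosedFieldType) (n c : nat) (mu : 'I_n -> C)
    (B : 'I_c -> 'M[C]_n)
    (B_herm : forall a, (B a)^t* = B a) (B_proj : forall a, B a *m B a = B a)
    (B_sum : \sum_a B a = 1%:M)
    (B_null : forall a, B a *m diag_mx (\row_j mu j) *m B a = 0) :
  exists K : 'I_n -> 'I_n -> C,
    [/\ forall i j, 0 <= K i j,
        forall j, \sum_i K i j = c%:R - 1,
        forall i, \sum_j K i j = c%:R - 1 &
        forall i, \sum_j mu j * K i j = - mu i].
Proof.
have sqrB a i j : `|B a i j| ^+ 2 = B a i j * B a j i.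
  by rewrite normCK -[in B a j i]B_herm !mxE.
have sumB i j : \sum_a B a i j = (i == j)%:R by rewrite -summxE B_sum mxE.
pose K i j : C := c%:R * \sum_a `|B a i j| ^+ 2 - (i == j)%:R.
have K_sym i j : K i j = K j i.
  rewrite /K eq_sym; congr (_ * _ - _); apply: eq_bigr => a _.
  by rewrite !sqrB mulrC.
have K_row i : \sum_j K i j = c%:R - 1.
  have -> : \sum_j K i j
      = c%:R * (\sum_a \sum_j `|B a i j| ^+ 2) - \sum_j (i == j)%:R.
    by rewrite sumrB -mulr_sumr exchange_big.
  have -> : \sum_j (i == j)%:R = 1 :> C.
    rewrite (bigD1 i) //= eqxx big1 ?addr0 // => j /negbTE.
    by rewrite eq_sym => ->.
  under eq_bigr => a _.
    under eq_bigr => j _ do rewrite sqrB.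
    have -> : \sum_j B a i j * B a j i = B a i i by rewrite -[in RHS]B_proj mxE.
    over.
  by rewrite sumB eqxx mulr1.
exists K; split => // [i j|j|i].
- rewrite subr_ge0; apply: le_trans (sqr_norm_sum_le (fun a => B a i j)).
  by rewrite sumB; case: eqP => _; rewrite ?normr1 ?normr0 ?expr1n ?expr0n.
- by under eq_bigr => i _ do rewrite K_sym; exact: K_row.
under eq_bigr => j _ do rewrite /K mulrBr mulrCA.
rewrite sumrB -mulr_sumr.
have -> : \sum_j mu j * \sum_a `|B a i j| ^+ 2 = 0.
  under eq_bigr => j _ do rewrite mulr_sumr.
  rewrite exchange_big big1 //= => a _.
  have /matrixP/(_ i i) := B_null a; rewrite [in RHS]mxE mxE => null_ii.
  rewrite -[RHS]null_ii; apply: eq_bigr => j _.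
  by rewrite mul_mx_diag !mxE sqrB; ring.
rewrite mulr0 sub0r (bigD1 i) //= eqxx mulr1 big1 ?addr0 // => j /negbTE.
by rewrite eq_sym => ->; rewrite mulr0.
Qed.

(** The sign of [tail] is needed to divide by it. It comes from [K] alone:
    summing [\sum_j mu j * K i j = - mu i] over [i] gives
    [(c - 1) * \sum_j mu j = - \sum_j mu j], so [mu] has sum [0], and the [m]
    smallest of numbers of mean [0] have nonpositive sum. *)
Lemma majorization_bound (F : numFieldType) (n c m : nat) (mu : 'I_n -> F)
    (K : 'I_n -> 'I_n -> F)
    (mu_mono : forall i j : 'I_n, (i <= j)%N -> mu j <= mu i)
    (K_ge0 : forall i j, 0 <= K i j)
    (K_col : forall j, \sum_i K i j = c%:R - 1)
    (K_row : forall i, \sum_j K i j = c%:R - 1)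
    (K_mu : forall i, \sum_j mu j * K i j = - mu i)
    (c_gt0 : (0 < c)%N) (m_gt0 : (0 < m)%N) (m_le : (m <= n)%N)
    (tail := \sum_(j < n | (n - m <= j)%N) mu j) :
  \sum_(i < n | (i < m)%N) mu i <= (c%:R - 1) * - tail /\ tail <= 0.
Proof.
split.
  rewrite mulrN lerNr -sumrN.
  under eq_bigr => i _ do rewrite -K_mu.
  rewrite exchange_big /=; under eq_bigr => j _ do rewrite -mulr_sumr.
  apply: weighted_sum_ge_tail => // [j|j|]; first exact: sumr_ge0.
    rewrite -(K_col j) [leRHS](bigID (fun i : 'I_n => (i < m)%N)) /=.
    by rewrite lerDl sumr_ge0.
  rewrite exchange_big /=; under eq_bigr => i _ do rewrite K_row.
  rewrite -(big_ord_widen _ (fun=> c%:R - 1)) //.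
  by rewrite sumr_const card_ord mulr_natl.
have tr0 : \sum_j mu j = 0.
  have : c%:R * \sum_j mu j = 0.
    have : \sum_i \sum_j mu j * K i j = - \sum_i mu i.
      by rewrite -sumrN; apply: eq_bigr.
    rewrite exchange_big /=.
    under eq_bigr => j _ do rewrite -mulr_sumr K_col mulrC.
    by rewrite -mulr_sumr mulrBl mul1r => /eqP; rewrite subr_eq addNr => /eqP.
  by move/eqP; rewrite mulf_eq0 pnatr_eq0 -[_ == 0]negbK -lt0n c_gt0 /= => /eqP.
(* The constant weights m out of a maximal weight n have total m * n. *)
have := @weighted_sum_ge_tail F n m mu (fun=> m%:R) n%:R mu_mono m_gt0 m_le.
rewrite -mulr_suml tr0 mul0r pmulr_rle0 ?ltr0n ?(leq_trans m_gt0) //; apply.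
- by move=> _; rewrite ler0n.
- by move=> _; rewrite ler_nat.
- by rewrite sumr_const card_ord mulr_natr.
Qed.

(** * Eigenbases in a prescribed order *)

Lemma char_poly_invmx_conj (F : fieldType) (n : nat) (P D : 'M[F]_n) :
  P \in unitmx -> char_poly (invmx P *m D *m P) = char_poly D.
Proof.
move=> Pu; rewrite /char_poly.
have -> : char_poly_mx (invmx P *m D *m P)
    = map_mx polyC (invmx P) *m char_poly_mx D *m map_mx polyC P.
  rewrite /char_poly_mx !map_mxM mulmxBr mulmxBl; congr (_ - _).
  by rewrite mul_mx_scalar -scalemxAl -map_mxM mulVmx // map_mx1 scalemx1.
by rewrite !det_mulmx mulrAC -det_mulmx -map_mxM mulVmx // map_mx1 det1 mul1r.
Qed.

(** The spectral theorem provides the eigenvalues in some uncontrolled order.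
    The characteristic polynomial shows that [s] is a rearrangement of them, and
    the same permutation applied to the rows of the unitary matrix puts the
    eigenvectors in the order of [s]. *)
Lemma normal_spectral_tuple (C : numClosedFieldType) (n : nat) (A : 'M[C]_n)
    (s : n.-tuple C) (A_normal : A \is normalmx)
    (A_char : char_poly A = \prod_(x <- s) ('X - x%:P)) :
  exists2 W : 'M[C]_n, W \is unitarymx &
    A = W^t* *m diag_mx (\row_j tnth s j) *m W.
Proof.
pose P := spectralmx A; pose d := spectral_diag A.
have P_unitary : P \is unitarymx by apply: spectral_unitarymx.
have A_eq : A = invmx P *m diag_mx d *m P by apply/orthomx_spectralP.
have : perm_eq s [tuple d 0 i | i < n].
  apply: prod_XsubC_eq; rewrite -A_char A_eq char_poly_invmx_conj; last first.
    exact: unitarymx_unit.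
  rewrite char_poly_trig ?diag_mx_is_trig // big_tuple.
  by apply: eq_bigr => i _; rewrite mxE eqxx mulr1n tnth_mktuple.
case/tuple_permP => p s_eq.
have sE i : tnth s i = d 0 (p i).
  have -> : s = [tuple tnth [tuple d 0 i | i < n] (p i) | i < n].
    exact: val_inj.
  by rewrite !tnth_mktuple.
exists (row_perm p P).
  apply/unitarymxP/matrixP => i j.
  have /unitarymxP/matrixP/(_ (p i) (p j)) := P_unitary.
  rewrite !mxE (inj_eq perm_inj) => <-.
  by apply: eq_bigr => k _; rewrite !mxE.
rewrite [LHS]A_eq invmx_unitary //; apply/matrixP => k l.
rewrite !mul_mx_diag !mxE (reindex_inj (@perm_inj _ p)) /=.
by apply: eq_bigr => i _; rewrite !mxE sE.
Qed.

(** The matrices [E a] form a resolution of the identity by orthogonal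
    projections that all compress [A] to [0]; a proper colouring is the source of
    such a family. *)
Lemma partial_sums_bound (C : numClosedFieldType) (n c m : nat) (A : 'M[C]_n)
    (s : n.-tuple C) (E : 'I_c -> 'M[C]_n)
    (A_normal : A \is normalmx)
    (A_char : char_poly A = \prod_(x <- s) ('X - x%:P))
    (s_mono : forall i j : 'I_n, (i <= j)%N -> tnth s j <= tnth s i)
    (E_herm : forall a, (E a)^t* = E a) (E_proj : forall a, E a *m E a = E a)
    (E_sum : \sum_a E a = 1%:M) (E_null : forall a, E a *m A *m E a = 0)
    (c_gt0 : (0 < c)%N) (m_gt0 : (0 < m)%N) (m_le : (m <= n)%N)
    (tail := \sum_(j < n | (n - m <= j)%N) tnth s j) :
  \sum_(i < n | (i < m)%N) tnth s i <= (c%:R - 1) * - tail /\ tail <= 0.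
Proof.
have [W W_unitary A_eq] := normal_spectral_tuple A_normal A_char.
have WtW : W^t* *m W = 1%:M.
  by rewrite -invmx_unitary // mulVmx // unitarymx_unit.
pose B a := W *m E a *m W^t*.
have [||||K [K_ge0 K_col K_row K_mu]] := @majorization_kernel C n c (tnth s) B.
- move=> a; rewrite /B trmx_mul map_mxM trmx_mul map_mxM /= E_herm.
  by rewrite trmxCK mulmxA.
- move=> a; rewrite /B -!mulmxA [W^t* *m _]mulmxA WtW mul1mx.
  by rewrite [E a *m _]mulmxA E_proj.
- by rewrite -mulmx_suml -mulmx_sumr E_sum mulmx1; apply/unitarymxP.
- move=> a; transitivity (W *m (E a *m A *m E a) *m W^t*).
    by rewrite A_eq /B !mulmxA.
  by rewrite E_null mulmx0 mul0mx.
exact: majorization_bound s_mono K_ge0 K_col K_row K_mu c_gt0 m_gt0 m_le.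
Qed.

(** * From colourings to eigenvalues *)

Lemma colorable_gt0 (n : nat) (G : sgraph n) (c : nat) :
  (0 < n)%N -> colorable G c -> (0 < c)%N.
Proof.
case: n G => // n G _ /existsP[Phi _].
by case: c Phi => // Phi; case: (Phi ord0).
Qed.

Lemma eigenvalue_sums_bound (R : rcfType) (n c m : nat) (G : sgraph n)
    (mu : n.-tuple R) (G_col : colorable G c)
    (hmu : sorted_eigenvalues (adjmx R G) mu)
    (m_gt0 : (0 < m)%N) (m_le : (m <= n)%N)
    (tail := \sum_(0 <= i < m) mu`_(n - i.+1)) :
  \sum_(0 <= i < m) mu`_i <= (c%:R - 1) * - tail /\ tail <= 0.
Proof.
have c_gt0 : (0 < c)%N by apply: colorable_gt0 G_col; apply: leq_trans m_le.
have [/existsP[Phi /forallP Phi_col] [mu_sorted mu_char]] := (G_col, hmu).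
pose toC : {rmorphism R -> R[i]} := real_complex R.
pose s := map_tuple toC mu.
pose A := map_mx toC (adjmx R G).
have s_nth j : tnth s j = toC mu`_j by rewrite tnth_map (tnth_nth 0).
have A_adj k l : A k l = (G k l)%:R by rewrite !mxE rmorph_nat.
have A_normal : A \is normalmx.
  have A_herm : A^t* = A.
    by apply/matrixP=> k l; rewrite mxE [A^T _ _]mxE !A_adj conjC_nat adj_sym.
  by apply/normalmxP; rewrite A_herm.
have A_char : char_poly A = \prod_(x <- s) ('X - x%:P).
  rewrite -map_char_poly mu_char rmorph_prod big_map.
  by apply: eq_bigr => x _; rewrite /= map_polyXsubC.
have s_mono (i j : 'I_n) : (i <= j)%N -> tnth s j <= tnth s i.
  move=> le_ij; rewrite !s_nth lecR.
  have ge_trans : transitive (>=%R : rel R).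
    by move=> x y z /[swap]; apply: le_trans.
  have mu_homo := sorted_leq_nth ge_trans (@lexx _ R) 0 mu_sorted.
  by apply: mu_homo; rewrite ?inE ?size_tuple.
pose E a : 'M[R[i]]_n := diag_mx (\row_k (Phi k == a)%:R).
have [] := @partial_sums_bound R[i] n c m A s E A_normal A_char s_mono
  _ _ _ _ c_gt0 m_gt0 m_le.
- move=> a; apply/matrixP => k l; rewrite !mxE rmorphMn /= conjC_nat.
  by case: (eqVneq k l) => [->|].
- move=> a; rewrite mulmx_diag; congr diag_mx; apply/rowP => k.
  by rewrite !mxE; case: eqP; rewrite ?mulr1 ?mulr0.
- rewrite -raddf_sum; apply/matrixP => k l; rewrite !mxE summxE; congr (_ *+ _).
  rewrite (bigD1 (Phi k)) //= mxE eqxx big1 ?addr0 // => a /negbTE.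
  by rewrite mxE eq_sym => ->.
- move=> a; apply/matrixP => k l.
  rewrite mul_mx_diag mul_diag_mx !mxE rmorph_nat.
  have /forallP/(_ l)/implyP := Phi_col k.
  case: (G k l) => [/(_ isT)|_]; last by rewrite mulr0 mul0r.
  case: (eqVneq (Phi k) a) => [->|_ _]; last by rewrite !mul0r.
  by rewrite eq_sym => /negbTE ->; rewrite mulr0.
have -> : \sum_(i < n | (i < m)%N) tnth s i = toC (\sum_(0 <= i < m) mu`_i).
  under eq_bigr => i _ do rewrite s_nth.
  by rewrite rmorph_sum big_mkord (big_ord_widen n (fun i => toC mu`_i)).
have -> : \sum_(j < n | (n - m <= j)%N) tnth s j = toC tail.
  under eq_bigr => i _ do rewrite s_nth.
  by rewrite (sum_last_ord (fun j => toC mu`_j)) // rmorph_sum.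
rewrite -(rmorph_nat toC) -(rmorph1 toC) -rmorphB -rmorphN -rmorphM.
by rewrite -(rmorph0 toC) !lecR.
Qed.

(* The maximum is over a nonempty range since 1 < n; its first term serves as
   the default value of the iterated maximum. *)
Theorem theorem1p1 (R : rcfType) (n : nat) (hn : (1 < n)%N) (G : sgraph n)
    (mu : n.-tuple R) (hmu : sorted_eigenvalues (adjmx R G) mu) :
  1 + \big[Num.max/eigen_ratio mu 1]_(1 <= m < n) eigen_ratio mu m
    <= (chromatic_number G)%:R.
Proof.
have G_col : colorable G (chromatic_number G).
  by rewrite /chromatic_number; case: ex_minnP.
have c_gt0 : (0 < chromatic_number G)%N.
  by apply: colorable_gt0 G_col; apply: ltnW.
have ratio_le m : (0 < m < n)%N ->
    eigen_ratio mu m <= (chromatic_number G)%:R - 1.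
  case/andP=> m_gt0 /ltnW m_le.
  have [top_le] := eigenvalue_sums_bound G_col hmu m_gt0 m_le.
  rewrite /eigen_ratio -oppr_ge0 le0r => /orP[/eqP-> | tail_gt0].
    by rewrite invr0 mulr0 subr_ge0 ler1n.
  by rewrite ler_pdivrMr.
rewrite addrC -lerBrDr big_nat; elim/big_ind: _ => [|x y x_le y_le|m //].
- by rewrite ratio_le.
- by rewrite ge_max x_le.
exact: ratio_le.
Qed.
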